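(* Let $n\ge 1$ be an integer, let $0<p,t<1$, and let $\lambda=n-\alpha<0$ (so $\alpha>n$ is real) satisfy $$\frac1p+\frac1t+\frac{\lambda}{n}=2.$$ Then there is a best (i.e. largest possible) constant $N^*(n,\alpha,p)>0$ such that, for all nonnegative $f\in L^p(\mathbb{R}^n)$ and $g\in L^t(\mathbb{R}^n)$, $$\int_{\mathbb{R}^n}\int_{\mathbb{R}^n} f(x)\,|x-y|^{-\lambda}\,g(y)\,dx\,dy\ \ge\ N^*(n,\alpha,p)\,\|f\|_{L^p(\mathbb{R}^n)}\,\|g\|_{L^t(\mathbb{R}^n)}.$$
   Context: For $0<p<1$, $f\in L^p(\mathbb{R}^n)$ means that $f$ is measurable and $\int_{\mathbb{R}^n}|f|^p\,dx<\infty$, and $\|f\|_{L^p(\mathbb{R}^n)}:=\big(\int_{\mathbb{R}^n}|f|^p\,dx\big)^{1/p}$ (this is not a norm in the usual sense). The double integral on the left is a Lebesgue integral of a nonnegative function and is allowed to equal $+\infty$. *)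

(* Defs.v *)
From HB Require Import structures.
From mathcomp Require Import all_boot all_order all_algebra.
From mathcomp Require Import all_classical all_reals all_analysis.

Set Implicit Arguments.
Unset Strict Implicit.
Unset Printing Implicit Defensive.

Import Order.TTheory GRing.Theory Num.Theory.
Import numFieldNormedType.Exports.

Local Open Scope classical_set_scope.
Local Open Scope ring_scope.
Local Open Scope ereal_scope.

Section rn_cons.
Context {R : realType}.

Definition rn_cons n (xt : measurableTypeR R * n.-tuple R) : n.+1.-tuple R :=
  [tuple of xt.1 :: xt.2].

Definition rn_uncons n (t : n.+1.-tuple R) : measurableTypeR R * n.-tuple R :=
  (thead t, [tuple of behead t]).

Lemma measurable_rn_cons n : measurable_fun setT (@rn_cons n).
Proof.
apply: (@measurable_cons _ _ (measurableTypeR R * n.-tuple R)%type R fst n snd).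
  exact: (@measurable_fst _ _ (measurableTypeR R) (n.-tuple R)).
exact: (@measurable_snd _ _ (measurableTypeR R) (n.-tuple R)).
Qed.

Lemma measurable_rn_uncons n : measurable_fun setT (@rn_uncons n).
Proof.
apply/measurable_fun_pairP; split; last exact: measurable_behead.
exact: (@measurable_tnth _ R n.+1 ord0).
Qed.

Lemma rn_consK n : cancel (@rn_cons n) (@rn_uncons n).
Proof. by case=> x t; congr pair; exact: val_inj. Qed.

Lemma rn_unconsK n : cancel (@rn_uncons n) (@rn_cons n).
Proof. by move=> t; rewrite [RHS]tuple_eta. Qed.

End rn_cons.

Section borel_lebesgue_step.
Context {R : realType} {n : nat}.
Variable mu : {sigma_finite_measure set (n.-tuple R) -> \bar R}.

Definition borel_lebesgue_step : set (n.+1.-tuple R) -> \bar R :=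
  pushforward (@lebesgue_measure R \x mu) (@rn_cons R n).

Let step0 : borel_lebesgue_step set0 = 0.
Proof. by rewrite /borel_lebesgue_step /pushforward preimage_set0 measure0. Qed.

Let step_ge0 A : 0 <= borel_lebesgue_step A.
Proof. exact: integral_ge0. Qed.

Let step_sigma_additive : semi_sigma_additive borel_lebesgue_step.
Proof.
have mf := @measurable_rn_cons R n.
move=> F mF tF mUF; rewrite /borel_lebesgue_step /pushforward preimage_bigcup.
apply: measure_semi_sigma_additive.
- by move=> i; rewrite -[X in measurable X]setTI; exact: mf.
- apply/trivIsetP => /= i j _ _ ij; rewrite -preimage_setI.
  by move/trivIsetP : tF => /(_ _ _ _ _ ij) ->//; rewrite preimage_set0.
- by rewrite -preimage_bigcup -[X in measurable X]setTI; exact: mf.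
Qed.

HB.instance Definition _ := isMeasure.Build _ _ _ borel_lebesgue_step
  step0 step_ge0 step_sigma_additive.

Let step_sigma_finite : sigma_finite setT borel_lebesgue_step.
Proof.
have /sigma_finiteP[F [FT ndF Foo]] := sigma_finiteT (@lebesgue_measure R).
have /sigma_finiteP[G [GT ndG Goo]] := sigma_finiteT mu.
exists (fun i => @rn_uncons R n @^-1` (F i `*` G i)).
  rewrite -preimage_bigcup; apply/esym.
  rewrite -[RHS](preimage_setT (@rn_uncons R n)).
  congr (_ @^-1` _); apply/seteqP; split=> // -[x y] _.
  have [i _ Fx] : (\bigcup_i F i) x by rewrite -FT.
  have [j _ Gy] : (\bigcup_i G i) y by rewrite -GT.
  exists (maxn i j) => //; split.
  - by move: x Fx; exact/subsetPset/ndF/leq_maxl.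
  - by move: y Gy; exact/subsetPset/ndG/leq_maxr.
move=> i; have [mF Fi] := Foo i; have [mG Gi] := Goo i; split.
  rewrite -[X in measurable X]setTI; apply: measurable_rn_uncons => //.
  exact: measurableX.
rewrite /borel_lebesgue_step /pushforward -comp_preimage.
rewrite (_ : _ \o _ = id) ?preimage_id; last exact/funext/rn_consK.
by rewrite product_measure1E// lte_mul_pinfty// ge0_fin_numE.
Qed.

HB.instance Definition _ := Measure_isSigmaFinite.Build _ _ _
  borel_lebesgue_step step_sigma_finite.

End borel_lebesgue_step.

Section lebesgue_rn.
Variable R : realType.

(* Lebesgue measure on the Borel sets of R^n, the n-fold product of the
   one-dimensional Lebesgue measure (R^0 carries the unit point mass). *)
Fixpoint borel_lebesgue_rn (n : nat) :
    {sigma_finite_measure set (n.-tuple R) -> \bar R} :=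
  match n with
  | 0%N => \d_[tuple]
  | m.+1 => borel_lebesgue_step (borel_lebesgue_rn m)
  end.

(* R^n with the sigma-algebra of Lebesgue measurable sets, i.e. the sets that
   are Caratheodory measurable for the Lebesgue outer measure. *)
Definition Rn (n : nat) := caratheodory_type (borel_lebesgue_rn n)^*%mu.

HB.instance Definition _ (n : nat) := Measurable.on (Rn n).

Definition lebesgue_rn (n : nat) : set (Rn n) -> \bar R :=
  @completed_measure_extension _ _ _ (borel_lebesgue_rn n).

HB.instance Definition _ (n : nat) := Measure.on (@lebesgue_rn n).

Let lebesgue_rn_sigma_finite n : sigma_finite setT (@lebesgue_rn n).
Proof. exact/completed_measure_extension_sigma_finite/sigma_finiteT. Qed.

HB.instance Definition _ (n : nat) := Measure_isSigmaFinite.Build _ _ _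
  (@lebesgue_rn n) (@lebesgue_rn_sigma_finite n).

End lebesgue_rn.

Section lebesgue_rn_box.
Variable R : realType.

Lemma measurable_box n (A : 'I_n -> set R) : (forall i, measurable (A i)) ->
  measurable [set t : n.-tuple R | forall i, A i (tnth t i)].
Proof.
move=> mA; rewrite (_ : [set _ | _] =
    \big[setI/setT]_(i < n) ((fun t : n.-tuple R => tnth t i) @^-1` A i)).
  apply: bigsetI_measurable => i _; rewrite -[X in measurable X]setTI.
  exact: measurable_tnth.
apply/seteqP; split=> t /=.
  move=> At; rewrite -bigcap_seq => i _; exact: At.
by rewrite -bigcap_seq => At i; apply: At; rewrite /= mem_index_enum.
Qed.

Lemma borel_lebesgue_rn_box n (A : 'I_n -> set R) :
  (forall i, measurable (A i)) ->
  borel_lebesgue_rn R n [set t | forall i, A i (tnth t i)] =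
  \prod_(i < n) lebesgue_measure (A i).
Proof.
elim: n A => [|n IH] A mA.
  rewrite big_ord0 /= diracE mem_set//=; by case.
rewrite big_ord_recl -IH; last by move=> i; exact: mA.
have mA' : measurable
    [set t : n.-tuple R | forall i, A (lift ord0 i) (tnth t i)].
  exact: (@measurable_box n (fun i => A (lift ord0 i))).
apply: etrans (product_measure1E lebesgue_measure (borel_lebesgue_rn R n)
  (mA ord0) mA').
rewrite /= /borel_lebesgue_step /pushforward; congr (product_measure1 _ _ _).
apply/seteqP; split=> -[x t] /=.
  move=> At; split; first exact: (At ord0).
  by move=> i; move: (At (lift ord0 i)); rewrite /rn_cons tnthS.
move=> [Ax At] i; have [j ->|->//] := unliftP ord0 i.
by rewrite /rn_cons tnthS.
Qed.

Lemma lebesgue_rn_box n (A : 'I_n -> set R) : (forall i, measurable (A i)) ->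
  @lebesgue_rn R n [set t | forall i, A i (tnth t i)] =
  \prod_(i < n) lebesgue_measure (A i).
Proof.
move=> mA; rewrite -borel_lebesgue_rn_box//.
by apply: measurable_mu_extE; exact: measurable_box.
Qed.

End lebesgue_rn_box.

Section reverse_HLS.
Context {R : realType} {n : nat}.
Implicit Types f g : Rn R n -> R.

(* Euclidean distance; the norm of 'rV[R]_n in the library is the sup norm. *)
Definition eucl_dist (x y : Rn R n) : R :=
  Num.sqrt (\sum_(i < n) (tnth x i - tnth y i) ^+ 2)%R.

(* LfunType is not available here: it takes a proof of 1 <= p. *)
Definition Lp (p : R) (f : Rn R n -> R) : Prop :=
  measurable_fun setT f /\
  \int[@lebesgue_rn R n]_x (`|f x| `^ p)%:E < +oo.

Definition reverse_HLS (p t lambda N : R) : Prop :=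
  forall f g,
    (forall x, (0 <= f x)%R) -> (forall y, (0 <= g y)%R) -> Lp p f -> Lp t g ->
    N%:E * 'N[@lebesgue_rn R n]_p%:E[EFin \o f]
         * 'N[@lebesgue_rn R n]_t%:E[EFin \o g] <=
    \int[@lebesgue_rn R n]_y \int[@lebesgue_rn R n]_x
      (f x * eucl_dist x y `^ (- lambda) * g y)%:E.

End reverse_HLS.
Arguments reverse_HLS {R} n.

(* Main.v *)
Require Import Defs.
From mathcomp Require Import all_boot all_order all_algebra.
From mathcomp Require Import all_classical all_reals all_analysis.
From mathcomp Require Import measurable_realfun ring lra.

(** Write k = -lambda, a = n(1/p - 1), b = n(1/t - 1), so that k = a + b, and
    let w_r(x, z) = max(1, |x - z| / r).  A reverse Hoelder inequality against
    the weight w_r^k, valid because k > a, bounds [\int u w_r^k] below by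
    [c ||u||_p r^(-a)].  Choose a radius r at which f^p concentrates: every ball
    of radius r carries at most half of [\int f^p], some ball B(z, 2r) carries
    at least half.  The part of f outside B(y, r) (when y is near z) or inside
    B(z, 2r) (when y is far from z) then shows that the potential
    [\int f(x) |x - y|^k dx] is at least [c ||f||_p r^b w_(4r)(y, z)^k].
    Integrating against g, the same weighted inequality for g gives the factor
    [||g||_t r^(-b)], and the powers of r cancel.  The best constant is the
    supremum of the admissible ones, which is finite because the pair f = g =
    indicator of the unit cube has a finite double integral. *)

Import Order.TTheory GRing.Theory Num.Theory.
Import numFieldNormedType.Exports.

Local Open Scope classical_set_scope.
Local Open Scope ring_scope.

(* Unlike [ge0_le_integral], this needs no measurability: the integral of a
   nonnegative function is a supremum over the simple functions below it. *)
Lemma le_integral_ge0 d (T : measurableType d) (R : realType)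
    (mu : {measure set T -> \bar R}) (D : set T) (f g : T -> \bar R) :
  (forall x, D x -> 0 <= f x)%E -> (forall x, D x -> f x <= g x)%E ->
  (\int[mu]_(x in D) f x <= \int[mu]_(x in D) g x)%E.
Proof.
move=> f0 fg.
have g0 x : D x -> (0 <= g x)%E.
  by move=> Dx; apply: le_trans (fg _ Dx); exact: f0.
rewrite !ge0_integralE//; apply: ge_ereal_sup => _ /= [h hf <-].
apply: ereal_sup_ubound; exists h => // x; apply: le_trans (hf x) _.
by rewrite !patchE; case: ifPn => // /set_mem /fg.
Qed.

Lemma powR_le_split (R : realType) (s sigma a : R) : 0 < s -> s < 1 ->
  0 < sigma -> 0 <= a -> a `^ s <= sigma `^ (s - 1) * a + sigma `^ s.
Proof.
move=> s0 s1 sg0 a0; have [asg|sga] := leP a sigma.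
  rewrite -[leLHS]add0r lerD ?mulr_ge0 ?powR_ge0//.
  by rewrite ge0_ler_powR ?nnegrE ?(ltW s0) ?(ltW sg0).
have a1 : 0 < a by exact: lt_trans sga.
rewrite -[leLHS]addr0 lerD ?powR_ge0//.
rewrite -(mulr_powRB1 a0 s0) mulrC ler_wpM2r//.
rewrite -opprB !powRN lef_pV2 ?posrE ?powR_gt0//.
by rewrite ge0_ler_powR ?nnegrE ?subr_ge0 ?ltW.
Qed.

Section euclidean_balls.
Context {R : realType} {n : nat}.
Implicit Types x y z : Rn R n.

Lemma measurable_tnth_Rn (i : 'I_n) :
  measurable_fun setT (fun x : Rn R n => tnth x i).
Proof.
move=> _ B mB.
apply: caratheodory_measurable_mu_ext.
exact: (@measurable_tnth _ R n i).
Qed.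

Lemma measurable_eucl_dist y : measurable_fun setT (fun x => eucl_dist x y).
Proof.
apply: (measurableT_comp (f := @Num.sqrt R)).
  by apply: continuous_measurable_fun; exact: sqrt_continuous.
apply: measurable_sum => i.
apply: (measurable_funX 2).
apply: measurable_funB; [exact: measurable_tnth_Rn | exact: measurable_cst].
Qed.

Lemma eucl_dist_ge0 x y : 0 <= eucl_dist x y.
Proof. exact: sqrtr_ge0. Qed.

Lemma sqr_eucl_dist x y :
  eucl_dist x y ^+ 2 = \sum_(i < n) (tnth x i - tnth y i) ^+ 2.
Proof. by rewrite sqr_sqrtr// sumr_ge0// => i _; rewrite sqr_ge0. Qed.

Lemma eucl_distC x y : eucl_dist x y = eucl_dist y x.
Proof. by congr Num.sqrt; apply: eq_bigr => i _; rewrite -sqrrN opprB. Qed.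

Lemma tnth_le_eucl_dist x y i : `|tnth x i - tnth y i| <= eucl_dist x y.
Proof.
rewrite -(@ler_pXn2r _ 2) ?nnegrE ?eucl_dist_ge0// sqr_eucl_dist.
rewrite real_normK ?num_real// (bigD1 i)//= lerDl.
by apply: sumr_ge0 => j _; rewrite sqr_ge0.
Qed.

Lemma sqr_eucl_dist_triangle x y z :
  eucl_dist x z ^+ 2 <= 2 * eucl_dist x y ^+ 2 + 2 * eucl_dist y z ^+ 2.
Proof.
rewrite !sqr_eucl_dist !mulr_sumr -big_split/= ler_sum// => i _.
have := sqr_ge0 ((tnth x i - tnth y i) - (tnth y i - tnth z i)).
nra.
Qed.

Lemma eucl_dist_far x y z r : eucl_dist x z <= r -> 2 * r <= eucl_dist y z ->
  eucl_dist y z / 2 <= eucl_dist x y.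
Proof.
move=> xz yz; rewrite leNgt; apply/negP => xy.
have := sqr_eucl_dist_triangle y x z; rewrite [eucl_dist y x]eucl_distC.
move: (eucl_dist_ge0 x z) (eucl_dist_ge0 x y) (eucl_dist_ge0 y z).
move: xz yz xy; move: (eucl_dist x z) (eucl_dist x y) (eucl_dist y z) => a b c.
nra.
Qed.

Lemma lebesgue_eball_le z r : 0 <= r ->
  measurable [set x | eucl_dist x z <= r] ->
  (lebesgue_rn [set x | (eucl_dist x z <= r)%R] <= ((2 * r) ^+ n)%:E)%E.
Proof.
move=> r0 mball.
pose A (i : 'I_n) := `[tnth z i - r, tnth z i + r]%classic.
have mA i : measurable (A i) by exact: measurable_itv.
have -> : ((2 * r) ^+ n)%:E =
    (@lebesgue_rn R n) [set t | forall i, A i (tnth t i)].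
  rewrite lebesgue_rn_box// (eq_bigr (fun=> (2 * r)%:E)).
    by rewrite prodEFin prodr_const card_ord.
  move=> i _; rewrite /A lebesgue_measure_itv/= lte_fin.
  case: ifPn => [_|]; first by rewrite -EFinD; congr EFin; ring.
  by rewrite -leNgt => ?; congr EFin; lra.
apply: le_measure; rewrite ?inE.
- exact: mball.
- by apply: caratheodory_measurable_mu_ext; exact: measurable_box.
move=> x xz i; rewrite /A /= in_itv/=.
move: (le_trans (tnth_le_eucl_dist x z i) xz); rewrite ler_norml.
by move=> /andP[? ?]; apply/andP; split; lra.
Qed.

End euclidean_balls.

Section ball_growth.
Context d (T : measurableType d) (R : realType).
Context (mu : {measure set T -> \bar R}) (dist : T -> T -> R) (n : nat).
Context (dist_ge0 : forall x y, 0 <= dist x y).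
Context (measurable_dist : forall z, measurable_fun setT (fun x => dist x z)).

Definition cball z r : set T := [set x | dist x z <= r].
Arguments cball z r%_R.

Context (ball_growth : forall z r, 0 <= r ->
  (mu (cball z r) <= ((2 * r) ^+ n)%:E)%E).

Lemma cball_exhaust r z x : 0 < r -> exists k, cball z (r * 2 ^+ k) x.
Proof.
move=> r0; exists (Num.bound (dist x z / r)).
rewrite /cball/= -ler_pdivrMl// mulrC.
apply: le_trans (ltW (archi_boundP _)) _; first by rewrite divr_ge0// ltW.
by rewrite -natrX ler_nat ltnW// ltn_expl.
Qed.

Lemma cball_sub z r1 r2 : r1 <= r2 -> cball z r1 `<=` cball z r2.
Proof. by move=> r12 x /le_trans; apply. Qed.

Definition weight r z x : R := Num.max 1 (dist x z / r).

Lemma weight_ge1 r z x : 1 <= weight r z x.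
Proof. by rewrite /weight le_max lexx. Qed.

Lemma weight_gt0 r z x : 0 < weight r z x.
Proof. by rewrite (lt_le_trans _ (weight_ge1 r z x)). Qed.

Lemma measurable_cball z r : measurable (cball z r).
Proof.
rewrite -[cball z r]setTI.
have -> : cball z r = (fun x => dist x z) @^-1` `]-oo, r].
  by apply/seteqP; split=> x /=; rewrite in_itv.
exact: measurable_dist.
Qed.

Lemma measurable_weight r z : measurable_fun setT (weight r z).
Proof.
apply: measurable_maxr; first exact: measurable_cst.
by apply: measurable_funM => //; exact: measurable_cst.
Qed.

Lemma measurable_weight_powR r z a :
  measurable_fun setT (fun x => weight r z x `^ a).
Proof.
exact: (measurableT_comp (measurable_powR a) (measurable_weight r z)).
Qed.

Lemma weight_le_dyadic (m r : R) z x : 0 < m -> 0 < r ->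
  ((weight r z x `^ (- m))%:E <=
  \sum_(k <oo) ((2 `^ (- m)) ^+ k * \1_(cball z (r * 2 ^+ k.+1)) x)%:E)%E.
Proof.
move=> m0 r0.
have ex : exists k, x \in cball z (r * 2 ^+ k.+1).
  have [k xk] := cball_exhaust r z x r0; exists k; rewrite inE.
  apply: cball_sub xk; rewrite ler_wpM2l ?(ltW r0)//.
  by rewrite ler_weXn2l// ler1n.
have [k kx kmin] := ex_minnP ex.
pose u k := ((2 `^ (- m)) ^+ k * \1_(cball z (r * 2 ^+ k.+1)) x : R)%:E.
have u0 j : (0 <= u j)%E.
  by rewrite lee_fin mulr_ge0// exprn_ge0// powR_ge0.
apply: le_trans (nneseries_lim_ge k.+1 (fun j _ _ => u0 j)).
rewrite big_nat_recr//=; apply: le_trans (leeDr _ _); last first.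
  by apply: sume_ge0 => j _; exact: u0.
rewrite lee_fin indicE kx mulr1.
have step : 2 ^+ k <= weight r z x.
  case: k kx kmin => [|k] _ kmin; first exact: weight_ge1.
  have : x \notin cball z (r * 2 ^+ k.+1).
    by apply/negP => /kmin; rewrite ltnn.
  rewrite notin_setE /cball/= => /negP; rewrite -ltNge => h.
  by rewrite /weight le_max ler_pdivlMr// mulrC (ltW h) orbT.
rewrite -powR_mulrn ?powR_ge0// -powRrM mulrC powRrM powR_mulrn//.
rewrite !powRN lef_pV2 ?posrE ?powR_gt0 ?weight_gt0//.
  by rewrite ge0_ler_powR ?nnegrE ?(ltW m0)// ltW// weight_gt0.
Qed.

Lemma integral_weight_le (m : R) : n%:R < m -> exists2 C, 0 < C &
  forall r z, 0 < r ->
    (\int[mu]_x (weight r z x `^ (- m))%:E <= (C * r ^+ n)%:E)%E.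
Proof.
move=> nm; have m0 : 0 < m by exact: le_lt_trans nm.
pose q := 2 `^ (- m) : R; pose t := 2 ^+ n * q.
have q0 : 0 < q by exact: powR_gt0.
have t0 : 0 < t by rewrite mulr_gt0// exprn_gt0.
have t1 : t < 1.
  rewrite /t /q powRN -powR_mulrn// ltr_pdivrMr ?powR_gt0// mul1r.
  by rewrite /powR pnatr_eq0/= ltr_expR ltr_pM2r// ln_gt0// ltr1n.
exists (4 ^+ n * (1 - t)^-1) => [|r z r0].
  by rewrite mulr_gt0 ?exprn_gt0// invr_gt0 subr_gt0.
pose u k x := (q ^+ k * \1_(cball z (r * 2 ^+ k.+1)) x : R)%:E.
have u0 k x : (0 <= u k x)%E by rewrite lee_fin mulr_ge0// exprn_ge0// ltW.
have mu_ k : measurable_fun setT (u k).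
  apply/measurable_EFinP; apply: measurable_funM; first exact: measurable_cst.
  by apply: measurable_indic; exact: measurable_cball.
apply: le_trans (_ : (\int[mu]_x \sum_(k <oo) u k x <= _)%E).
  apply: le_integral_ge0 => x _; first by rewrite lee_fin powR_ge0.
  exact: weight_le_dyadic.
rewrite integral_nneseries//.
apply: lime_le.
  by apply: is_cvg_nneseries => k _ _; apply: integral_ge0.
apply: nearW => N.
apply: le_trans (_ : (\sum_(0 <= k < N) ((4 * r) ^+ n * t ^+ k)%:E <= _)%E).
  apply: lee_sum => k _.
  rewrite /u; under eq_integral do rewrite EFinM.
  rewrite ge0_integralZl_EFin; first last.
  - by rewrite exprn_ge0// ltW.
  - by apply/measurable_EFinP; apply: measurable_indic; exact: measurable_cball.
  - by move=> x _; rewrite lee_fin.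
  - exact: measurableT.
  rewrite integral_indic//; last exact: measurable_cball.
  rewrite setIT.
  have rk0 : 0 <= r * 2 ^+ k.+1 by rewrite mulr_ge0 ?exprn_ge0// ltW.
  have qk0 : (0 <= (q ^+ k)%:E)%E by rewrite lee_fin exprn_ge0// ltW.
  apply: le_trans (lee_wpmul2l qk0 (ball_growth z _ rk0)) _.
  rewrite -EFinM lee_fin /t le_eqVlt; apply/orP; left; apply/eqP.
  have -> : 2 * (r * 2 ^+ k.+1) = 4 * r * 2 ^+ k by rewrite exprS; ring.
  rewrite [LHS]mulrC !exprMn -!mulrA; congr (_ * (_ * (_ * _))).
  by rewrite exprAC.
rewrite sumEFin lee_fin -mulr_sumr exprMn [leRHS]mulrAC.
apply: ler_wpM2l; first by rewrite mulr_ge0 ?exprn_ge0// ltW.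
have := @geometric_le_lim R N 1 t ler01 t0.
rewrite (ger0_norm (ltW t0)) => /(_ t1).
rewrite mul1r; apply: le_trans; rewrite /series /=.
by under [leRHS]eq_bigr do rewrite mul1r.
Qed.

Lemma integral_weight_ge (s k : R) : 0 < s -> s < 1 ->
  n%:R * (s^-1 - 1) < k -> exists2 c, 0 < c &
  forall (D : set T) (u : T -> R) (r : R) z (S : R),
    measurable D -> measurable_fun setT u -> (forall x, 0 <= u x) ->
    0 < r -> 0 < S -> (S%:E <= \int[mu]_(x in D) (u x `^ s)%:E)%E ->
    ((c * S `^ s^-1 * r `^ (- (n%:R * (s^-1 - 1))))%:E <=
      \int[mu]_(x in D) (u x * weight r z x `^ k)%:E)%E.
Proof.
move=> s0 s1 smu; have sN0 : s != 0 by rewrite gt_eqF.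
have s1_gt0 : 0 < 1 - s by rewrite subr_gt0.
have s1_neq0 : 1 - s != 0 by rewrite gt_eqF.
pose m := k / (1 - s) * s.
have nm : n%:R < m.
  rewrite /m mulrAC ltr_pdivlMr// -ltr_pdivrMr//.
  by move: smu; rewrite -mulrA mulrBl mul1r divff.
have [C C0 wC] := integral_weight_le m nm.
have C1 : 0 < 2 * (1 + C) by lra.
pose c := (2 * (1 + C)) `^ (- s^-1).
have c0 : 0 < c by exact: powR_gt0.
exists c => // D u r z S mD mu_ u0 r0 S0 Sle.
rewrite leNgt; apply/negP => intJ.
pose K := c * S `^ s^-1 * r `^ (- (n%:R / s)).
have K0 : 0 < K by rewrite !mulr_gt0// powR_gt0.
have JK : c * S `^ s^-1 * r `^ (- (n%:R * (s^-1 - 1))) = K * r ^+ n.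
  rewrite /K -[RHS]mulrA -powR_mulrn ?(ltW r0)// -powRD; last first.
    by apply/implyP => _; rewrite gt_eqF.
  by congr (_ * _ `^ _); ring.
have Ks : K `^ s * r ^+ n = S / (2 * (1 + C)).
  rewrite /K !powRM ?mulr_ge0 ?powR_ge0//.
  rewrite /c -!powRrM mulNr mulVf// mulNr divfK// powRr1 ?(ltW S0)//.
  rewrite powR_inv1 ?(ltW C1)// powRN powR_mulrn ?(ltW r0)//.
  rewrite -mulrA mulVf ?mulr1; first by rewrite mulrC.
  by rewrite expf_neq0// gt_eqF.
clearbody K.
have pointwise x : u x `^ s <=
    K `^ (s - 1) * (u x * weight r z x `^ k) + K `^ s * weight r z x `^ (- m).
  set w := weight r z x; have w0 : 0 < w by exact: weight_gt0.
  have := @powR_le_split R s (K * w `^ (- (k / (1 - s)))) (u x) s0 s1.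
  rewrite mulr_gt0 ?powR_gt0// => /(_ isT (u0 x)).
  rewrite !powRM ?powR_ge0 ?(ltW K0)// -!powRrM.
  have -> : - (k / (1 - s)) * (s - 1) = k by field.
  by rewrite mulNr -mulrA [w `^ k * u x]mulrC.
have mw a : measurable_fun D (fun x => weight r z x `^ a).
  by apply: measurable_funTS; exact: measurable_weight_powR.
have muD : measurable_fun D u by exact: measurable_funTS.
have w_ge0 a x : 0 <= weight r z x `^ a by exact: powR_ge0.
have : (\int[mu]_(x in D) (u x `^ s)%:E <=
    (K `^ (s - 1) * (K * r ^+ n) + K `^ s * (C * r ^+ n))%:E)%E.
  apply: le_trans (_ : (\int[mu]_(x in D)
    ((K `^ (s - 1))%:E * (u x * weight r z x `^ k)%:E +
     (K `^ s)%:E * (weight r z x `^ (- m))%:E) <= _)%E).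
    apply: le_integral_ge0 => x _; first by rewrite lee_fin powR_ge0.
    by rewrite -!EFinM -EFinD lee_fin.
  rewrite ge0_integralD//; first last.
  - by apply/measurable_EFinP; apply: measurable_funM.
  - by move=> x _; rewrite -EFinM lee_fin mulr_ge0 ?powR_ge0.
  - apply/measurable_EFinP; apply: measurable_funM; first exact: measurable_cst.
    exact: measurable_funM.
  - by move=> x _; rewrite -EFinM lee_fin !mulr_ge0 ?powR_ge0.
  rewrite EFinD; apply: leeD.
    rewrite ge0_integralZl_EFin//; first last.
    - exact: powR_ge0.
    - by apply/measurable_EFinP; exact: measurable_funM.
    - by move=> x _; rewrite lee_fin mulr_ge0.
    by rewrite EFinM lee_wpmul2l ?lee_fin ?powR_ge0// -JK ltW.
  rewrite ge0_integralZl_EFin//; first last.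
  - exact: powR_ge0.
  - exact/measurable_EFinP.
  - by move=> x _; rewrite lee_fin.
  rewrite EFinM lee_wpmul2l ?lee_fin ?powR_ge0//.
  apply: le_trans (wC r z r0); apply: ge0_subset_integral => //.
  - by apply/measurable_EFinP; exact: measurable_weight_powR.
  - by move=> x _; rewrite lee_fin.
move/(le_trans Sle); rewrite lee_fin leNgt => /negP; apply.
have -> : K `^ (s - 1) * (K * r ^+ n) + K `^ s * (C * r ^+ n) =
    (1 + C) * (K `^ s * r ^+ n).
  by rewrite -(mulr_powRB1 (ltW K0) s0); ring.
have -> : (1 + C) * (K `^ s * r ^+ n) = S / 2.
  by rewrite Ks; field; rewrite gt_eqF//; lra.
lra.
Qed.

Lemma concentration_scale (v : T -> R) (S : R) : (0 < n)%N ->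
  measurable_fun setT v -> (forall x, 0 <= v x) -> 0 < S ->
  (\int[mu]_x (v x)%:E = S%:E)%E ->
  exists r z, [/\ 0 < r,
    forall y, (\int[mu]_(x in cball y r) (v x)%:E <= (S / 2)%:E)%E &
    ((S / 2)%:E <= \int[mu]_(x in cball z (2 * r)) (v x)%:E)%E].
Proof.
move=> n0 mv v0 S0 intv.
have mEv : measurable_fun setT (EFin \o v) by exact/measurable_EFinP.
have iv : mu.-integrable setT (EFin \o v).
  apply/integrableP; split=> //.
  under eq_integral do rewrite /= ger0_norm//.
  by rewrite intv ltry.
have S20 : 0 < S / 2 by lra.
have [d0 [d00 small]] := integral_normr_continuous iv S20.
pose r0 := Num.min 1 d0 / 4.
have m0 : 0 < Num.min 1 d0 by rewrite lt_min ltr01.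
have m1 : Num.min 1 d0 <= 1 by rewrite ge_min lexx.
have md : Num.min 1 d0 <= d0 by rewrite ge_min lexx orbT.
have r00 : 0 < r0 by rewrite divr_gt0.
pose P j := `[< exists z,
  ((S / 2)%:E <= \int[mu]_(x in cball z (r0 * 2 ^+ j)) (v x)%:E)%E >].
have P0 : ~~ P 0%N.
  apply/negP => /asboolP[z]; rewrite expr0 mulr1 leNgt => /negP; apply.
  have mc := measurable_cball z r0.
  have /(small _ mc) : (mu (cball z r0) < d0%:E)%E.
    apply: le_lt_trans (ball_growth z r0 (ltW r00)) _; rewrite lte_fin.
    rewrite -(prednK n0); apply: (@le_lt_trans _ _ (2 * r0)).
      rewrite exprS; apply: ler_piMr; first by rewrite mulr_ge0// ltW.
      by apply: exprn_ile1; [rewrite mulr_ge0// ltW | rewrite /r0; lra].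
    by rewrite /r0; lra.
  rewrite /Rintegral -lte_fin fineK.
    by under eq_integral do rewrite ger0_norm//.
  under eq_integral do rewrite ger0_norm//.
  rewrite ge0_fin_numE; last by apply: integral_ge0 => x _; rewrite lee_fin.
  apply: le_lt_trans (ltry S); rewrite -intv.
  by apply: ge0_subset_integral => // x _; rewrite lee_fin.
have exP : exists j, P j.
  apply/not_existsP => nP.
  have := @ge0_nondecreasing_set_cvg_integral _ _ _
    (fun j => cball point (r0 * 2 ^+ j)) (EFin \o v) mu.
  have -> : \bigcup_j cball point (r0 * 2 ^+ j) = setT.
    apply/seteqP; split=> // x _.
    by have [j xj] := cball_exhaust r0 point x r00; exists j.
  move=> h; have {h} :
      (\int[mu]_(x in cball point (r0 * 2 ^+ j)) (EFin \o v) x)%E @[j --> \oo]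
      --> (\int[mu]_x (EFin \o v) x)%E.
    apply: h.
    - move=> i j ij; apply/subsetPset/cball_sub.
      by rewrite ler_wpM2l ?(ltW r00)// ler_weXn2l// ler1n.
    - by move=> i; exact: measurable_cball.
    - by move=> i; exact: measurable_funTS.
    - by move=> i x _; rewrite lee_fin.
  rewrite /= intv => cv.
  have : (S%:E <= (S / 2)%:E)%E.
    rewrite -(cvg_lim _ cv)//; apply: lime_le.
      by apply/cvg_ex; exists S%:E.
    apply: nearW => j; rewrite leNgt; apply/negP => hj.
    by apply: (nP j); apply/asboolP; exists point; exact: ltW.
  by rewrite lee_fin; lra.
case: (ex_minnP exP) => -[|k]; first by rewrite (negbTE P0).
move=> /asboolP[z hz] kmin; exists (r0 * 2 ^+ k), z; split.
- by rewrite mulr_gt0// exprn_gt0.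
- move=> y; rewrite leNgt; apply/negP => hy.
  suff /kmin : P k by rewrite ltnn.
  by apply/asboolP; exists y; exact: ltW.
- by rewrite mulrCA -exprS.
Qed.

(* A weak form of the triangle inequality. *)
Context (dist_far : forall x y z r, dist x z <= r -> 2 * r <= dist y z ->
  dist y z / 2 <= dist x y).

Lemma reverse_HLS_bound (p t k : R) : (0 < n)%N ->
  0 < p -> p < 1 -> 0 < t -> t < 1 ->
  k = n%:R * (p^-1 - 1) + n%:R * (t^-1 - 1) ->
  exists2 N, 0 < N & forall (f g : T -> R) (S U : R),
    measurable_fun setT f -> measurable_fun setT g ->
    (forall x, 0 <= f x) -> (forall x, 0 <= g x) -> 0 < S -> 0 < U ->
    (\int[mu]_x (f x `^ p)%:E = S%:E)%E ->
    (\int[mu]_x (g x `^ t)%:E = U%:E)%E ->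
    ((N * S `^ p^-1 * U `^ t^-1)%:E <=
     \int[mu]_y \int[mu]_x (f x * dist x y `^ k * g y)%:E)%E.
Proof.
move=> n0 p0 p1 t0 t1 kE.
have nR0 : 0 < n%:R :> R by rewrite ltr0n.
set a := n%:R * (p^-1 - 1) in kE; set b := n%:R * (t^-1 - 1) in kE.
have a0 : 0 < a by rewrite mulr_gt0// subr_gt0 invf_gt1.
have b0 : 0 < b by rewrite mulr_gt0// subr_gt0 invf_gt1.
have k0 : 0 < k by rewrite kE addr_gt0.
have [|cp cp0 lower_p] := @integral_weight_ge p k p0 p1.
  by rewrite -/a kE ltrDl.
have [|ct ct0 lower_t] := @integral_weight_ge t k t0 t1.
  by rewrite -/b kE ltrDr.
exists (cp * (2^-1) `^ p^-1 * ct * 4 `^ (- b)).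
  by rewrite !mulr_gt0 ?powR_gt0.
move=> f g S U mf mg f0 g0 S0 U0 fS gU.
have mfp : measurable_fun setT (fun x => f x `^ p).
  exact: (measurableT_comp (measurable_powR p)).
have S20 : 0 < S / 2 by rewrite divr_gt0.
have [r [z [r0 ball_small ball_big]]] :=
  concentration_scale _ S n0 mfp (fun x => powR_ge0 (f x) p) S0 fS.
have mker y : measurable_fun setT (fun x => dist x y `^ k).
  exact: (measurableT_comp (measurable_powR k)).
have mfker y : measurable_fun setT (fun x => f x * dist x y `^ k).
  exact: measurable_funM.
have ker_lower (D : set T) (rho kappa : R) c y : measurable D -> 0 < rho ->
    0 <= kappa -> ((S / 2)%:E <= \int[mu]_(x in D) (f x `^ p)%:E)%E ->
    (forall x, D x -> kappa * weight rho c x `^ k <= dist x y `^ k) ->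
    ((kappa * (cp * (S / 2) `^ p^-1 * rho `^ (- a)))%:E <=
      \int[mu]_x (f x * dist x y `^ k)%:E)%E.
  move=> mD rho0 kappa0 SD ker.
  have h := lower_p D f rho c (S / 2) mD mf f0 rho0 S20 SD.
  rewrite EFinM; apply: le_trans (lee_wpmul2l _ h) _; first by rewrite lee_fin.
  have mw : measurable_fun D (fun x => f x * weight rho c x `^ k).
    apply: measurable_funTS; apply: measurable_funM => //.
    exact: measurable_weight_powR.
  rewrite -ge0_integralZl_EFin//; first last.
  - exact/measurable_EFinP.
  - by move=> x _; rewrite lee_fin mulr_ge0// powR_ge0.
  apply: le_trans (_ : (\int[mu]_(x in D) (f x * dist x y `^ k)%:E <= _)%E).
    apply: le_integral_ge0 => x Dx; rewrite -EFinM lee_fin.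
      by rewrite !mulr_ge0// powR_ge0.
    by rewrite mulrCA ler_wpM2l// ker.
  apply: ge0_subset_integral => //; first exact/measurable_EFinP.
  by move=> x _; rewrite lee_fin mulr_ge0// powR_ge0.
pose H := cp * (S / 2) `^ p^-1 * r `^ b.
have H0 : 0 <= H by rewrite !mulr_ge0 ?powR_ge0// ltW.
have potential y : ((H * weight (4 * r) z y `^ k)%:E <=
    \int[mu]_x (f x * dist x y `^ k)%:E)%E.
  have rpow x : 0 < x -> x `^ k * x `^ (- a) = x `^ b.
    move=> x0; rewrite -powRD; first by congr (_ `^ _); rewrite kE; ring.
    by apply/implyP => _; rewrite gt_eqF.
  have [yz|yz] := leP (dist y z) (4 * r).
    have -> : weight (4 * r) z y = 1.
      by apply/max_idPl; rewrite ler_pdivrMr ?mul1r// mulr_gt0.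
    rewrite powR1 mulr1.
    have -> : H = r `^ k * (cp * (S / 2) `^ p^-1 * r `^ (- a)).
      by rewrite /H -(rpow r r0); ring.
    have mb := measurable_cball y r.
    apply: (ker_lower (~` cball y r) r (r `^ k) y) => //.
    - exact: measurableC.
    - exact: powR_ge0.
    - rewrite leNgt; apply/negP => out.
      have mE : measurable_fun setT (fun x => (f x `^ p)%:E).
        exact/measurable_EFinP.
      have split : (\int[mu]_x (f x `^ p)%:E =
        \int[mu]_(x in cball y r) (f x `^ p)%:E +
        \int[mu]_(x in ~` cball y r) (f x `^ p)%:E)%E.
        rewrite -ge0_integral_setU ?setUv//; first exact: measurableC.
        - by move=> x _; rewrite lee_fin powR_ge0.
        - by apply/disj_set2P; rewrite setICr.
      have : (\int[mu]_(x in cball y r) (f x `^ p)%:E +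
        \int[mu]_(x in ~` cball y r) (f x `^ p)%:E < (S / 2)%:E + (S / 2)%:E)%E.
        apply: lee_ltD => //.
        rewrite ge0_fin_numE; first exact: le_lt_trans (ball_small y) (ltry _).
        by apply: integral_ge0 => x _; rewrite lee_fin powR_ge0.
      by rewrite -split fS -EFinD lte_fin -splitr ltxx.
    - move=> x /= /negP; rewrite /cball/= -ltNge => rx.
      rewrite -powRM ?(ltW r0) ?(ltW (weight_gt0 _ _ _))//.
      have -> : weight r y x = dist x y / r.
        by apply/max_idPr; rewrite ler_pdivlMr// mul1r ltW.
      by rewrite mulrC divfK// gt_eqF.
  have d0 : 0 < dist y z by apply: lt_trans yz; rewrite mulr_gt0.
  have r20 : 0 < 2 * r by rewrite mulr_gt0.
  apply: le_trans (_ : ((dist y z / 2) `^ k *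
     (cp * (S / 2) `^ p^-1 * (2 * r) `^ (- a)))%:E <= _)%E.
    have -> : weight (4 * r) z y = dist y z / (4 * r).
      by apply/max_idPr; rewrite ler_pdivlMr ?mul1r ?mulr_gt0// ltW.
    have -> : dist y z / 2 = dist y z / (4 * r) * (2 * r).
      by field; rewrite gt_eqF.
    rewrite lee_fin [in leRHS]powRM ?(ltW r20)//; last first.
      by rewrite divr_ge0// mulr_ge0// ltW.
    rewrite [leRHS](_ : _ = cp * (S / 2) `^ p^-1 * (2 * r) `^ b *
        (dist y z / (4 * r)) `^ k); last by rewrite -(rpow _ r20); ring.
    rewrite ler_wpM2r ?powR_ge0// ler_wpM2l ?mulr_ge0 ?powR_ge0 ?(ltW cp0)//.
    rewrite ge0_ler_powR ?nnegrE ?(ltW b0) ?(ltW r0) ?(ltW r20)//.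
    by rewrite ler_peMl ?(ltW r0)// ler1n.
  apply: (ker_lower (cball z (2 * r)) _ _ z) => //.
  - exact: measurable_cball.
  - exact: powR_ge0.
  - move=> x xz.
    have -> : weight (2 * r) z x = 1.
      by apply/max_idPl; rewrite ler_pdivrMr ?mul1r.
    rewrite powR1 mulr1 ge0_ler_powR ?nnegrE ?(ltW k0) ?dist_ge0//.
      by rewrite divr_ge0.
    by apply: dist_far xz _; rewrite mulrA -natrM ltW.
apply: le_trans (_ : (\int[mu]_y
  (H%:E * (g y * weight (4 * r) z y `^ k)%:E) <= _)%E); last first.
  apply: le_integral_ge0 => y _.
    rewrite -EFinM lee_fin; apply: mulr_ge0 => //.
    by rewrite mulr_ge0 ?powR_ge0.
  under eq_integral do rewrite EFinM.
  rewrite ge0_integralZr//; first last.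
  - by rewrite lee_fin.
  - by move=> x _; rewrite lee_fin mulr_ge0 ?powR_ge0.
  - exact/measurable_EFinP.
  rewrite -EFinM mulrCA mulrC EFinM.
  by apply: lee_wpmul2r; rewrite ?lee_fin.
have mgw : measurable_fun setT (fun y => g y * weight (4 * r) z y `^ k).
  by apply: measurable_funM => //; exact: measurable_weight_powR.
rewrite ge0_integralZl_EFin//; first last.
- exact/measurable_EFinP.
- by move=> x _; rewrite lee_fin mulr_ge0 ?powR_ge0.
have r40 : 0 < 4 * r by rewrite mulr_gt0.
have := lower_t setT g (4 * r) z U measurableT mg g0 r40 U0.
rewrite gU lexx => /(_ isT) h.
have HE : (0 <= H%:E)%E by rewrite lee_fin.
apply: le_trans (lee_wpmul2l HE h).
have rb : r `^ b * r `^ (- b) = 1 by rewrite powRN mulfV// gt_eqF ?powR_gt0.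
rewrite -EFinM lee_fin -/b powRM ?(ltW r0)// /H [(S / 2) `^ _]powRM ?(ltW S0)//.
rewrite [leRHS](_ : _ = cp * 2^-1 `^ p^-1 * ct * 4 `^ (- b) * S `^ p^-1 *
  U `^ t^-1 * (r `^ b * r `^ (- b))); last by ring.
by rewrite rb mulr1.
Qed.

End ball_growth.

Lemma Lnorm_ge0_EFin d (T : measurableType d) (R : realType)
    (mu : {measure set T -> \bar R}) (p : R) (f : T -> R) :
  (forall x, 0 <= f x) -> (\int[mu]_x (`|f x| `^ p)%:E < +oo)%E ->
  exists S, [/\ 0 <= S, (\int[mu]_x (f x `^ p)%:E = S%:E)%E &
    'N[mu]_p%:E[EFin \o f]%E = (S `^ p^-1)%:E].
Proof.
move=> f0; under eq_integral do rewrite ger0_norm//.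
set I := (\int[mu]_x _)%E => Ioo.
have I0 : (0 <= I)%E by apply: integral_ge0 => x _; rewrite lee_fin powR_ge0.
have IE : I = (fine I)%:E by rewrite fineK// ge0_fin_numE.
exists (fine I); split; [exact: fine_ge0 | exact: IE |].
rewrite unlock -poweR_EFin -IE; congr (_ `^ _)%E.
by apply: eq_integral => x _ /=; rewrite ger0_norm.
Qed.

Lemma integral_indic_kernel_le d (T : measurableType d) (R : realType)
    (mu : {measure set T -> \bar R}) (k : T -> T -> R) (Q : set T) (M : R) :
  measurable Q -> mu Q = 1%E -> 0 <= M -> (forall x y, 0 <= k x y) ->
  (forall x y, Q x -> Q y -> k x y <= M) ->
  (\int[mu]_y \int[mu]_x (\1_Q x * k x y * \1_Q y)%:E <= M%:E)%E.
Proof.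
move=> mQ Q1 M0 k0 kM.
have mI : measurable_fun setT (fun x => (\1_Q x)%:E : \bar R).
  by apply/measurable_EFinP; exact: measurable_indic.
have I0 x : setT x -> (0 <= (\1_Q x)%:E :> \bar R)%E by rewrite lee_fin.
have IQ : (\int[mu]_x (\1_Q x)%:E = 1)%E by rewrite integral_indic// setIT.
rewrite -[leRHS]mule1 -IQ -ge0_integralZl_EFin//.
apply: le_integral_ge0 => y _.
  by apply: integral_ge0 => x _; rewrite lee_fin !mulr_ge0.
rewrite -EFinM -[leRHS]mule1 -IQ -ge0_integralZl_EFin ?mulr_ge0//.
apply: le_integral_ge0 => x _; first by rewrite lee_fin !mulr_ge0.
rewrite -EFinM lee_fin !indicE.
have [/set_mem Qx|_] := boolP (x \in Q); last by rewrite !mul0r mulr0.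
have [/set_mem Qy|_] := boolP (y \in Q); last by rewrite !mulr0 mul0r.
by rewrite !mulr1 mul1r kM.
Qed.

Section reverse_HLS_constants.
Context {R : realType} {n : nat}.

Lemma reverse_HLS_exists (p t lambda : R) : (0 < n)%N ->
  0 < p -> p < 1 -> 0 < t -> t < 1 ->
  - lambda = n%:R * (p^-1 - 1) + n%:R * (t^-1 - 1) ->
  exists2 N, 0 < N & reverse_HLS n p t lambda N.
Proof.
move=> n0 p0 p1 t0 t1 lamE.
have vol z r : 0 <= r ->
    (@lebesgue_rn R n (cball _ _ _ eucl_dist z r) <= ((2 * r) ^+ n)%:E)%E.
  move=> r0; apply: lebesgue_eball_le => //.
  exact: (measurable_cball _ _ _ eucl_dist measurable_eucl_dist).
have [N N0 hN] := reverse_HLS_bound _ _ _ (@lebesgue_rn R n) eucl_dist n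
  eucl_dist_ge0 measurable_eucl_dist vol eucl_dist_far p t (- lambda)
  n0 p0 p1 t0 t1 lamE.
exists N => // f g f0 g0 [mf fp] [mg gt].
have [S [S0 fS ->]] := Lnorm_ge0_EFin _ _ _ _ p f f0 fp.
have [U [U0 gU ->]] := Lnorm_ge0_EFin _ _ _ _ t g g0 gt.
rewrite -!EFinM.
have I0 : (0 <= \int[@lebesgue_rn R n]_y \int[@lebesgue_rn R n]_x
    (f x * eucl_dist x y `^ (- lambda) * g y)%:E)%E.
  apply: integral_ge0 => y _; apply: integral_ge0 => x _.
  by rewrite lee_fin !mulr_ge0// powR_ge0.
move: S0; rewrite le_eqVlt => /orP[/eqP <-|S0].
  by rewrite powR0 ?mulr0 ?mul0r// invr_eq0 gt_eqF.
move: U0; rewrite le_eqVlt => /orP[/eqP <-|U0].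
  by rewrite powR0 ?mulr0// invr_eq0 gt_eqF.
exact: hN.
Qed.

Lemma reverse_HLS_bounded (p t lambda : R) : 0 < p -> 0 < t -> lambda < 0 ->
  exists M, forall N, reverse_HLS n p t lambda N -> N <= M.
Proof.
move=> p0 t0 lam0.
pose Q : set (Rn R n) := [set x | forall i, `[0, 1]%classic (tnth x i)].
have mQ : measurable Q.
  apply: caratheodory_measurable_mu_ext.
  apply: (@measurable_box _ n (fun=> `[0, 1]%classic)).
  by move=> i; exact: measurable_itv.
have Q1 : lebesgue_rn Q = 1%E.
  rewrite (@lebesgue_rn_box R n (fun=> `[0, 1]%classic)).
    rewrite big1// => i _; rewrite lebesgue_measure_itv/= lte_fin ltr01.
    by rewrite sube0.
  by move=> i; exact: measurable_itv.
pose M : R := Num.sqrt n%:R `^ (- lambda).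
have kM (x y : Rn R n) : Q x -> Q y -> eucl_dist x y `^ (- lambda) <= M.
  move=> Qx Qy; rewrite ge0_ler_powR ?nnegrE ?eucl_dist_ge0 ?sqrtr_ge0//.
    by rewrite oppr_ge0 ltW.
  rewrite ler_wsqrtr// -[n in n%:R]card_ord -sumr_const.
  rewrite ler_sum// => i _; move: (Qx i) (Qy i).
  rewrite /= !in_itv/= => /andP[? ?] /andP[? ?]; nra.
pose f : Rn R n -> R := \1_Q.
have f0 x : 0 <= f x by rewrite /f indicE.
have mf : measurable_fun setT f by exact: measurable_indic.
have fpow a : 0 < a -> (\int[@lebesgue_rn R n]_x (f x `^ a)%:E = 1)%E.
  move=> a0; rewrite -Q1 -[Q in RHS]setIT.
  rewrite -(integral_indic (@lebesgue_rn R n))//.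
  apply: eq_integral => x _; rewrite /f indicE.
  by case: (x \in Q); rewrite ?powR1// powR0// gt_eqF.
have fLp a : 0 < a -> Lp a f.
  move=> a0; split=> //; under eq_integral do rewrite ger0_norm//.
  by rewrite fpow// ltry.
exists M => N /(_ f f f0 f0 (fLp _ p0) (fLp _ t0)).
have [S [_ + ->]] := Lnorm_ge0_EFin _ _ _ _ p f f0 (fLp _ p0).2.
rewrite fpow// => -[<-]; rewrite powR1.
have [U [_ + ->]] := Lnorm_ge0_EFin _ _ _ _ t f f0 (fLp _ t0).2.
rewrite fpow// => -[<-]; rewrite powR1 !mule1 -lee_fin => /le_trans; apply.
apply: (@integral_indic_kernel_le _ _ _ _
  (fun x y => eucl_dist x y `^ (- lambda))) => //.
- exact: powR_ge0.
- by move=> x y; exact: powR_ge0.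
Qed.

Lemma reverse_HLS_sup (p t lambda N0 : R) :
  reverse_HLS n p t lambda N0 ->
  reverse_HLS n p t lambda (sup [set N | reverse_HLS n p t lambda N]).
Proof.
move=> hN0 f g f0 g0 fp gt; set E := [set N | _].
have E0 : E !=set0 by exists N0.
have [S [S0 _ fS]] := Lnorm_ge0_EFin _ _ _ _ p f f0 fp.2.
have [U [U0 _ gU]] := Lnorm_ge0_EFin _ _ _ _ t g g0 gt.2.
have EI N : E N -> _ := fun EN => EN f g f0 g0 fp gt.
move: EI; rewrite fS gU.
set I := (\int[_]_y _)%E => EI.
have I0 : (0 <= I)%E.
  apply: integral_ge0 => y _; apply: integral_ge0 => x _.
  by rewrite lee_fin !mulr_ge0// powR_ge0.
case: I I0 EI => [i| |//] I0 EI; last by rewrite leey.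
rewrite -!EFinM lee_fin -mulrA.
have : 0 <= S `^ p^-1 * U `^ t^-1 by rewrite mulr_ge0// powR_ge0.
rewrite le_eqVlt => /orP[/eqP <-|su0]; first by rewrite mulr0 -lee_fin.
rewrite -ler_pdivlMr//; apply: ge_sup => // N EN.
by rewrite ler_pdivlMr// mulrA -lee_fin !EFinM; exact: EI.
Qed.

End reverse_HLS_constants.

Theorem theorem1p1 (R : realType) (n : nat) (p t alpha lambda : R)
    (n_ge1 : (1 <= n)%N)
    (p_gt0 : 0 < p) (p_lt1 : p < 1)
    (t_gt0 : 0 < t) (t_lt1 : t < 1)
    (lambdaE : lambda = n%:R - alpha) (lambda_lt0 : lambda < 0)
    (exponents : 1 / p + 1 / t + lambda / n%:R = 2) :
  exists Nstar : R,
    [/\ 0 < Nstar,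
        reverse_HLS n p t lambda Nstar
      & forall N : R, reverse_HLS n p t lambda N -> N <= Nstar].
Proof.
have n_neq0 : n%:R != 0 :> R by rewrite pnatr_eq0 -lt0n.
have lamE : - lambda = n%:R * (p^-1 - 1) + n%:R * (t^-1 - 1).
  have -> : lambda = (lambda / n%:R) * n%:R by rewrite divfK.
  have -> : lambda / n%:R = 2 - 1 / p - 1 / t by rewrite -exponents; ring.
  by rewrite !div1r; ring.
have [N0 N0_gt0 hN0] :=
  reverse_HLS_exists p t lambda n_ge1 p_gt0 p_lt1 t_gt0 t_lt1 lamE.
have [M hM] := @reverse_HLS_bounded R n p t lambda p_gt0 t_gt0 lambda_lt0.
have supE : has_sup [set N | reverse_HLS n p t lambda N].
  by split; [exists N0 | exists M].
exists (sup [set N | reverse_HLS n p t lambda N]); split.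
- by apply: lt_le_trans N0_gt0 _; exact: ub_le_sup supE.2 _ hN0.
- exact: reverse_HLS_sup hN0.
- by move=> N hN; exact: ub_le_sup supE.2 _ hN.
Qed.
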